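(* Let $H$ be a strongly 2-edge-connected Eulerian digraph. Then every edge of $H$ is contained in at least two peripheral cycles of $H$.
   Context: Digraphs may have parallel edges. A digraph is Eulerian if every vertex has indegree equal to its outdegree. A digraph $H$ is strongly 2-edge-connected if $H-F$ is strongly connected for every set $F\subseteq E(H)$ with $|F|<2$. A directed cycle $C$ in a digraph $H$ is peripheral if the digraph $H-E(C)$ (obtained by deleting the edges of $C$, keeping all vertices) is strongly connected. *)

(* Defs.v *)
From mathcomp Require Import all_boot.

Set Implicit Arguments.
Unset Strict Implicit.
Unset Printing Implicit Defensive.

(* Finite digraphs. Parallel edges are distinct elements of [edge H] with the
   same ends. Loops are excluded: a loop lies on only one directed cycle. *)
Record digraph := Digraph {
  vertex : finType;
  edge : finType;
  src : edge -> vertex;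
  tgt : edge -> vertex;
  no_loop : forall e : edge, src e != tgt e
}.

Definition outdeg (H : digraph) (v : vertex H) : nat :=
  #|[set e : edge H | src e == v]|.

Definition indeg (H : digraph) (v : vertex H) : nat :=
  #|[set e : edge H | tgt e == v]|.

Definition eulerian (H : digraph) : Prop :=
  forall v : vertex H, indeg v = outdeg v.

Definition adj (H : digraph) : rel (vertex H) :=
  [rel u v | [exists e : edge H, (src e == u) && (tgt e == v)]].

Definition strongly_connected (H : digraph) : Prop :=
  forall u v : vertex H, connect (@adj H) u v.

(* H - F: all vertices are kept. *)
Definition del_edges (H : digraph) (F : {set edge H}) : digraph :=
  @Digraph (vertex H) {e : edge H | e \notin F}
    (fun e => src (val e)) (fun e => tgt (val e))
    (fun e => no_loop (val e)).

Definition strongly_edge_connected (k : nat) (H : digraph) : Prop :=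
  forall F : {set edge H}, #|F| < k -> strongly_connected (del_edges F).

(* A directed cycle is represented by its edge set, so that rotations of a
   cyclic sequence of edges give the same cycle, while cycles through the same
   vertices along different parallel edges are different. *)
Definition dicycle (H : digraph) (C : {set edge H}) : Prop :=
  exists c : seq (edge H),
    [/\ c != [::],
        cycle [rel e f | tgt e == src f] c,
        uniq [seq src e | e <- c]
      & C = [set e in c]].

Definition peripheral (H : digraph) (C : {set edge H}) : Prop :=
  dicycle C /\ strongly_connected (del_edges C).

(* Main.v *)
Require Import Defs.
From mathcomp Require Import all_boot.

Set Implicit Arguments.
Unset Strict Implicit.
Unset Printing Implicit Defensive.

(* Given edges e <> f, choose a cycle C through e avoiding f for which the
   component K of H - C containing the tail of f is as large as possible.  As
   H - C is Eulerian, reachability in it is symmetric, so its components are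
   strongly connected and every edge between two of them lies on C.  If K
   misses a vertex, C leaves K at least twice, hence C - e contains a complete
   excursion from K: it leaves K through a and first returns through b.  The
   union X of the components met in between has an exit h other than b, and h
   lies on C outside the excursion.  So some component L <> K is met by C both
   inside and outside the excursion, and rerouting C - e through L frees a or
   b without using the edges of K, which enlarges K.  Hence for all e <> f some
   peripheral cycle contains e and avoids f; applying this again with f on the
   first peripheral cycle gives the second one. *)

(** * Walks and reachability off a set of edges *)

Section Walks.
Variable H : digraph.
Implicit Types (x y z : vertex H) (s p : seq (edge H)) (F C K X : {set edge H}).

(** Adjacency in [del_edges F], kept on the edges of [H] so that no subtype enters the later
    arguments. *)
Definition avoid F : rel (vertex H) :=
  [rel x y | [exists g : edge H, [&& g \notin F, src g == x & tgt g == y]]].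

Lemma avoidP F x y :
  reflect (exists g, [/\ g \notin F, src g = x & tgt g = y]) (avoid F x y).
Proof.
apply: (iffP existsP) => [[g /and3P[gF /eqP gx /eqP gy]]|[g [gF gx gy]]];
  by exists g => //; rewrite gF gx gy !eqxx.
Qed.

Lemma avoid_edge F g : g \notin F -> avoid F (src g) (tgt g).
Proof. by move=> gF; apply/avoidP; exists g. Qed.

Lemma adj_del_edges F x y : @adj (del_edges F) x y = avoid F x y.
Proof.
apply/existsP/avoidP => [[[g gF] /= /andP[/eqP gx /eqP gy]]|[g [gF gx gy]]].
  by exists g.
by exists (Sub g gF); rewrite /= gx gy !eqxx.
Qed.

Lemma strongly_connected_del F :
  strongly_connected (del_edges F) <-> forall x y, connect (avoid F) x y.
Proof.
split=> h x y; have := h x y;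
  by rewrite (eq_connect (@adj_del_edges F)).
Qed.

Fixpoint walk x s y : bool :=
  if s is g :: s' then (src g == x) && walk (tgt g) s' y else x == y.

Lemma walk_cat_cons x s1 g s2 y :
  walk x (s1 ++ g :: s2) y = walk x s1 (src g) && walk (tgt g) s2 y.
Proof.
elim: s1 x => [|h s1 IHs] x /=; first by rewrite eq_sym.
by rewrite IHs andbA.
Qed.

Lemma walk_connect F x s y :
  walk x s y -> {in s, forall g, g \notin F} -> connect (avoid F) x y.
Proof.
elim: s x => [|g s IHs] x /= => [/eqP-> //|/andP[/eqP <- wk] sF].
apply: connect_trans (connect1 (avoid_edge (sF g (mem_head _ _)))) _.
by apply: IHs => // h hs; apply: sF; rewrite in_cons hs orbT.
Qed.

Lemma walk_enters (K : {set vertex H}) x s y :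
  walk x s y -> x \notin K -> y \in K -> has [pred g | tgt g \in K] s.
Proof.
elim: s x => [|g s IHs] x /= => [/eqP-> /negPf-> //|/andP[_ wk] _ yK].
by case: (boolP (tgt g \in K)) => //= gK; apply: IHs wk gK yK.
Qed.

Lemma connect_exits (K : {set vertex H}) F x y :
  connect (avoid F) x y -> x \in K -> y \notin K ->
  exists g, [/\ g \notin F, src g \in K & tgt g \notin K].
Proof.
case/connectP=> s; elim: s x => [|z s IHs] x /= => [_ -> ->//|].
case/andP=> /avoidP[g [gF gx gz]] ps ly xK yK.
case: (boolP (z \in K)) => zK; first exact: IHs ps ly zK yK.
by exists g; rewrite gF gx gz.
Qed.

(** The equation with [belast] carries distinctness of the vertices over to the tails of the
    edges. *)
Lemma path_walk F x (vs : seq (vertex H)) :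
  path (avoid F) x vs ->
  exists s, [/\ walk x s (last x vs), {in s, forall g, g \notin F}
              & map (@src H) s = belast x vs].
Proof.
elim: vs x => [|z vs IHs] x /=; first by exists [::]; rewrite /= eqxx.
case/andP=> /avoidP[g [gF gx gz]] /IHs[s [wk sF ss]].
exists (g :: s); rewrite /= gx gz eqxx wk ss; split=> // h.
by rewrite in_cons => /predU1P[->|/sF].
Qed.

(** * Directed cycles *)

Lemma path_walk_cycle (e g : edge H) s :
  path [rel e f | tgt e == src f] e (rcons s g) = walk (tgt e) s (src g).
Proof. by elim: s e => [|h s IHs] e /=; rewrite ?andbT // IHs eq_sym. Qed.

Lemma dicycle_walk C e : dicycle C -> e \in C ->
  exists p, [/\ walk (tgt e) p (src e), uniq (map (@src H) (e :: p))
              & C = [set g in e :: p]].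
Proof.
case=> c [_ cc uc ->]; rewrite inE => /rot_to[i p rc]; exists p.
rewrite -path_walk_cycle -rc map_rot rot_uniq; split=> //.
  by have := cc; rewrite -(rot_cycle i) rc.
by apply: eq_finset => g; rewrite mem_rot.
Qed.

(** A path from the head of [e] to its tail can be shortened to one without repeated vertices, and
    [e] closes it to a cycle. *)
Lemma connect_dicycle F e :
  connect (avoid F) (tgt e) (src e) -> e \notin F ->
  exists C, [/\ dicycle C, e \in C & [disjoint C & F]].
Proof.
case/connectP=> vs0 /shortenP[vs pvs uvs _] eu eF.
have [s [wk sF ss]] := path_walk pvs.
exists [set g in e :: s]; split; last 1 first.
- rewrite disjoint_subset; apply/subsetP=> g.
  by rewrite !inE => /predU1P[->|/sF].
- exists (e :: s); split=> //; first by rewrite /= path_walk_cycle eu.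
  by rewrite map_cons ss eu cons_uniq -rcons_uniq -lastI.
by rewrite inE mem_head.
Qed.

(** A cycle with a single edge would be a loop. *)
Lemma dicycle_other_edge C e : dicycle C -> e \in C ->
  exists2 f, f \in C & f != e.
Proof.
move=> dC eC; have [[|f p] [wk uC ->]] := dicycle_walk dC eC.
  by have := no_loop e; rewrite eq_sym; move: wk => /= ->.
exists f; first by rewrite !inE eqxx orbT.
by move: uC => /= /andP[/norP[nef _] _]; apply: contraNneq nef => ->.
Qed.

(** Along a cycle the heads are the tails shifted by one place. *)
Lemma dicycle_balanced C v : dicycle C ->
  #|[set g in C | src g == v]| = #|[set g in C | tgt g == v]|.
Proof.
case=> c [_ cc uc ->].
have uc' : uniq c := map_uniq uc.
have count_c (a : pred (edge H)) : #|[set g in [set g in c] | a g]| = count a c.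
  rewrite -size_filter -(card_uniqP (filter_uniq a uc')).
  by apply: eq_card => g; rewrite !inE mem_filter andbC.
rewrite !count_c.
have tgt_src : map (@tgt H) c = rot 1 (map (@src H) c).
  case: c cc {uc uc' count_c} => //= e p; rewrite path_walk_cycle rot1_cons.
  move: (tgt e) (src e) => x y; elim: p x => [|g p IHp] x /= => [/eqP->//|].
  by case/andP=> /eqP-> /IHp ->.
rewrite -[LHS](count_map (@src H) (pred1 v)) -[RHS](count_map (@tgt H) (pred1 v)).
by rewrite tgt_src; apply/permP; rewrite perm_sym perm_rot.
Qed.

(** * Components of an Eulerian digraph minus a cycle *)

Hypothesis heul : eulerian H.

Lemma avoid_dicycle_sym C : dicycle C -> connect_sym (avoid C).
Proof.
move=> dC.
have deg_eq v : #|[set g in ~: C | src g == v]| = #|[set g in ~: C | tgt g == v]|.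
  have split_deg (a : pred (edge H)) :
      #|[set g | a g]| = #|[set g in C | a g]| + #|[set g in ~: C | a g]|.
    rewrite -(cardsID C); congr (_ + _); apply: eq_card => g;
    by rewrite !inE // andbC.
  apply/eqP; rewrite -(eqn_add2l #|[set g in C | src g == v]|) -split_deg.
  by rewrite (dicycle_balanced v dC) -split_deg; apply/eqP/esym/heul.
have deg_sum (S : {set vertex H}) :
    #|[set g in ~: C | src g \in S]| = #|[set g in ~: C | tgt g \in S]|.
  have sum_deg (end_ : edge H -> vertex H) :
      #|[set g in ~: C | end_ g \in S]| =
      \sum_(v in S) #|[set g in ~: C | end_ g == v]|.
    rewrite -sum1_card (partition_big end_ (mem S)) /=; last first.
      by move=> g; rewrite inE => /andP[].
    apply: eq_bigr => v vS; rewrite -sum1_card; apply: eq_bigl => g.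
    by rewrite !inE -andbA; case: (end_ g =P v) => [->|]; rewrite ?vS ?andbF.
  by rewrite !sum_deg; apply: eq_bigr => v _; apply: deg_eq.
(* The out-closed set reachable from y has as many edges entering as leaving,
   that is, none. *)
have back x y : avoid C x y -> connect (avoid C) y x.
  case/avoidP=> g [gC gx gy]; pose S := [set w | connect (avoid C) y w].
  have sub : [set g in ~: C | src g \in S] \subset [set g in ~: C | tgt g \in S].
    apply/subsetP=> h; rewrite !inE => /andP[hC hS]; rewrite hC /=.
    exact: connect_trans hS (connect1 (avoid_edge hC)).
  have /eqP/setP/(_ g) :
      [set g in ~: C | src g \in S] == [set g in ~: C | tgt g \in S].
    by rewrite eqEcard sub deg_sum leqnn.
  by rewrite !inE gC gx gy connect0.
suff imp x y : connect (avoid C) x y -> connect (avoid C) y x.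
  by move=> x y; apply/idP/idP; apply: imp.
case/connectP=> s; elim: s x => [|z s IHs] x /= => [_ ->//|].
case/andP=> xz ps ly; exact: connect_trans (IHs _ ps ly) (back _ _ xz).
Qed.

(** Forward reachability suffices: for a directed cycle [C] it is symmetric, so this is a strong
    component of [H - C]. *)
Definition component C x : {set vertex H} := [set y | connect (avoid C) x y].

Lemma component_avoid C x y z : dicycle C -> connect (avoid C) y z ->
  (y \in component C x) = (z \in component C x).
Proof.
move=> dC yz; rewrite !inE; exact: (same_connect_r (avoid_dicycle_sym dC) yz).
Qed.

(** A path of [H - C] that starts outside the component stays outside, so it uses no edge of [F]. *)
Lemma connect_off_component C F x y z : dicycle C ->
  {in F, forall g, (g \in C) || (src g \in component C x)} ->
  connect (avoid C) y z -> y \notin component C x -> connect (avoid F) y z.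
Proof.
move=> dC CF /connectP[s]; elim: s y => [|w s IHs] y /= => [_ ->//|].
case/andP=> yw ps lz yK.
have wK : w \notin component C x.
  by rewrite -(component_avoid x dC (connect1 yw)).
apply: connect_trans _ (IHs _ ps lz wK).
case/avoidP: yw => g [gC gy <-]; rewrite -gy; apply/connect1/avoid_edge.
by apply: contra yK => /CF; rewrite (negPf gC) gy.
Qed.

(** A cycle avoiding [F] leaves every edge of [H - C] inside the component intact, so the component
    cannot shrink; it grows strictly because [b], with exactly one end inside, becomes free. *)
Lemma reroute C x e b :
  let F := b |: [set g | (g \notin C) && (src g \in component C x)] in
  dicycle C -> e \in C -> e != b ->
  (src b \in component C x) != (tgt b \in component C x) ->
  connect (avoid F) (tgt e) (src e) ->
  exists C', [/\ dicycle C', e \in C', [disjoint C' & F]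
               & #|component C x| < #|component C' x|].
Proof.
move=> F dC eC eb bK vu.
have [|C' [dC' eC' C'F]] := connect_dicycle vu.
  by rewrite !inE negb_or eb eC.
exists C'; split=> //.
have notC' g : g \in F -> g \notin C'.
  by move=> gF; apply: contraTN gF => gC'; rewrite (disjointFr C'F).
have sub : component C x \subset component C' x.
  apply/subsetP=> y; rewrite 2!inE => xy.
  have inside z : z \in component C x -> connect (avoid C) z y ->
      connect (avoid C') z y; last by apply: inside xy; rewrite inE.
  move=> zK /connectP[s]; elim: s z zK => [|w s IHs] z zK /= => [_ ->//|].
  case/andP=> zw ps ly.
  have wK : w \in component C x by rewrite -(component_avoid x dC (connect1 zw)).
  apply: connect_trans _ (IHs _ wK ps ly).
  case/avoidP: zw => g [gC gz <-]; rewrite -gz; apply/connect1/avoid_edge/notC'.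
  by rewrite in_setU in_set gC gz zK orbT.
have bC' : (src b \in component C' x) = (tgt b \in component C' x).
  by apply/component_avoid/connect1/avoid_edge/notC'; rewrite ?setU11.
apply: proper_card; rewrite properEneq sub andbT.
by apply: contraNneq bK => ->; rewrite bC'.
Qed.

(** * Excursions of the cycle and enlargement of a component *)

Hypothesis hconn : strongly_edge_connected 2 H.

(** Otherwise deleting [b] would leave no way from [x] to [y]. *)
Lemma second_exit (X : {set vertex H}) x y (b : edge H) : x \in X -> y \notin X ->
  exists g, [/\ g != b, src g \in X & tgt g \notin X].
Proof.
move=> xX yX.
have /strongly_connected_del/(_ x y) sc : strongly_connected (del_edges [set b]).
  by apply: hconn; rewrite cards1.
by have [g [gb gX gnX]] := connect_exits sc xX yX; exists g; rewrite -in_set1.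
Qed.

Lemma excursion C x y e p :
  dicycle C -> y \notin component C x ->
  walk (tgt e) p (src e) -> C = [set g in e :: p] ->
  exists p1 a q b r, [/\ p = p1 ++ a :: q ++ b :: r, src a \in component C x,
    {in a :: q, forall g, tgt g \notin component C x},
    src b \notin component C x & tgt b \in component C x].
Proof.
set K := component C x => dC yK wk defC.
have xK : x \in K by rewrite inE.
have exitC g : src g \in K -> tgt g \notin K -> g \in C.
  move=> gK gnK; apply: contraNT gnK => gC.
  by rewrite -(component_avoid x dC (connect1 (avoid_edge gC))).
pose ex g := (src g \in K) && (tgt g \notin K).
have hasex : has ex p.
  (* Exits of [K] lie on [C], so one other than [e] lies on [p]. *)
  have [g [ge gK gnK]] := second_exit e xK yK.
  apply/hasP; exists g; last by rewrite /ex gK.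
  by have := exitC g gK gnK; rewrite defC !inE (negPf ge).
case: (split_find hasex) wk defC => a p1 p2 /andP[aK anK] nex.
rewrite cat_rcons walk_cat_cons => /andP[_ wk2] defC.
have ret : has [pred g | tgt g \in K] p2.
  (* As [a] is the first exit on [p], the exit [h] is [e] or comes after [a]; either way the walk
     after [a] must get back to the tail of [h], which is in [K]. *)
  have [h [ha hK hnK]] := second_exit a xK yK.
  have := exitC h hK hnK; rewrite defC !inE mem_cat in_cons (negPf ha) /=.
  case/or3P => [/eqP he|hp1|hp2].
  - by apply: walk_enters wk2 anK _; rewrite -he.
  - by case/hasP: nex; exists h; rewrite // /ex hK.
  - case/splitPr: hp2 wk2 => s1 s2; rewrite walk_cat_cons => /andP[wk3 _].
    by rewrite has_cat (walk_enters wk3 anK hK).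
case: (split_find ret) wk2 {defC} => b q r /= bK nq.
rewrite cat_rcons walk_cat_cons => /andP[wkq _].
exists p1, a, q, b, r; split=> //.
- move=> g; rewrite in_cons => /predU1P[->//|gq].
  by apply: contra nq => gK; apply/hasP; exists g.
- by apply: contra nq => /(walk_enters wkq anK).
Qed.

Lemma enlarge_component C e f y :
  dicycle C -> e \in C -> f \notin C -> y \notin component C (src f) ->
  exists C', [/\ dicycle C', e \in C', f \notin C'
               & #|component C (src f)| < #|component C' (src f)|].
Proof.
move=> dC eC fC yK; have [p [wk uC defC]] := dicycle_walk dC eC.
have [p1 [a [q [b [r [defp aK qK sbK tbK]]]]]] := excursion dC yK wk defC.
set K := component C (src f) in yK aK qK sbK tbK *.
have up : uniq (e :: p) := map_uniq uC.
(* Here [d] is the edge of [C] to be freed; it will be [a] or [b]. *)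
suff [d [dp dK vu]] : exists d, [/\ d \in p, (src d \in K) != (tgt d \in K)
    & connect (avoid (d |: [set g | (g \notin C) && (src g \in K)]))
              (tgt e) (src e)].
  have ed : e != d.
    by apply: contraTneq dp => <-; case/andP: up.
  have [C' [dC' eC' C'F lt]] := reroute dC eC ed dK vu.
  (* The edge [f] is off [C] with tail in [K], hence forbidden to [C']. *)
  exists C'; split=> //; apply/negP => fC'.
  by have := disjointFr C'F fC'; rewrite !inE fC connect0 orbT.
have pC g : g \in p -> g \in C by rewrite defC !inE => ->; rewrite orbT.
(* Pieces of [p] without [d] stay usable: the other forbidden edges are off [C]. *)
have seg d s z w : walk z s w -> {subset s <= p} -> d \notin s ->
    connect (avoid (d |: [set g | (g \notin C) && (src g \in K)])) z w.
  move=> wks sp ds; apply: walk_connect wks _ => g gs.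
  rewrite !in_setU !inE (pC _ (sp _ gs)) orbF.
  by apply: contraNneq ds => <-.
pose X := [set w | has (fun g => connect (avoid C) (tgt g) w) (a :: q)].
have taX : tgt a \in X by rewrite inE /= connect0.
have saX : src a \notin X.
  rewrite inE; apply/hasP=> -[g /qK gK ga].
  by rewrite (component_avoid _ dC ga) aK in gK.
have [h [hb]] := second_exit b taX saX.
rewrite inE => /hasP[g gq gh] hX.
(* [X] is closed under reachability in [H - C], so only edges of [C] leave it. *)
have hC : h \in C.
  apply: contraNT hX => hC; rewrite inE; apply/hasP; exists g => //.
  exact: connect_trans gh (connect1 (avoid_edge hC)).
have hq : h \notin a :: q.
  rewrite in_cons negb_or; apply/andP; split.
    by apply: contraNneq saX => <-; rewrite inE; apply/hasP; exists g.
  apply: contra hX => hq; rewrite inE; apply/hasP.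
  by exists h; rewrite ?in_cons ?hq ?orbT.
have through d z w : d \in p -> z \notin K -> connect (avoid C) z w ->
    connect (avoid (d |: [set g | (g \notin C) && (src g \in K)])) z w.
  move=> dp zK zw; apply: connect_off_component zw zK => //.
  move=> k; rewrite !inE => /predU1P[->|/andP[_ ->]]; last by rewrite orbT.
  by rewrite pC.
have hpos : [|| h == e, h \in p1 | h \in r].
  move: hC; rewrite defC defp inE in_cons mem_cat -cat_cons mem_cat (negPf hq).
  by rewrite in_cons (negPf hb).
have ap : a \in p by rewrite defp mem_cat in_cons eqxx orbT.
have bp : b \in p by rewrite defp -cat_cons !mem_cat mem_head !orbT.
have tgtK : tgt g \notin K := qK g gq.
have shK : src h \notin K by rewrite -(component_avoid _ dC gh).
have [s1 [s2 defaq]] : exists s1 s2, a :: q = s1 ++ g :: s2.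
  by case/splitPr: gq => s1 s2; exists s1, s2.
have defp2 : p = (p1 ++ s1) ++ g :: (s2 ++ b :: r).
  by rewrite defp -cat_cons defaq -!catA.
have upp : uniq p by case/andP: up.
(* If h precedes the excursion, the new path leaves C - e at the tail of h and
   rejoins it after a; otherwise it leaves before b and rejoins it at the tail
   of h. *)
case: (boolP (h \in p1)) => hp1.
  exists a; split=> //; first by rewrite aK (negPf (qK a _)) ?mem_head.
  case/splitPr: hp1 defp defp2 => t1 t2 defp defp2.
  move: (wk); rewrite {1}defp -catA walk_cat_cons => /andP[w1 _].
  move: (wk); rewrite {1}defp2 walk_cat_cons => /andP[_ w2].
  apply: connect_trans (seg a _ _ _ w1 _ _) _.
  - by move=> k kt; rewrite defp -catA mem_cat kt.
  - move: upp; rewrite defp -catA cat_uniq has_cat /= has_cat /=.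
    by apply: contraTN => ->; rewrite !orbT andbF.
  have hg : connect (avoid C) (src h) (tgt g) by rewrite avoid_dicycle_sym.
  apply: connect_trans (through _ _ _ ap shK hg) _.
  apply: (seg _ _ _ _ w2).
    by move=> k kt; rewrite defp2 mem_cat in_cons kt !orbT.
  have : uniq (a :: q ++ b :: r).
    by move: upp; rewrite defp cat_uniq => /and3P[].
  rewrite -cat_cons defaq -catA.
  (* If [s1] is empty then [g] is [a] itself; otherwise [a] is the head of [s1]. In both cases [a]
     comes before the piece after [g]. *)
  case: s1 defaq {defp2} => [|k s1] [-> _] /=; first by case/andP.
  case/andP=> nk _; apply: contra nk => ks.
  by rewrite mem_cat in_cons ks !orbT.
exists b; split=> //; first by rewrite tbK (negPf sbK).
have [bpre bpost] : b \notin p1 ++ a :: q /\ b \notin r.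
  move: upp; rewrite defp -cat_cons catA cat_uniq /= => /and3P[_ /norP[? _]].
  by case/andP.
move: (wk); rewrite {1}defp2 walk_cat_cons => /andP[w1 _].
have w1' : connect (avoid (b |: [set k | (k \notin C) && (src k \in K)]))
    (tgt e) (src g).
  apply: (seg _ _ _ _ w1).
    by move=> k kt; rewrite defp2 mem_cat kt.
  apply: contra bpre; rewrite defaq !mem_cat => /orP[|] ->; by rewrite ?orbT.
have gb : g \notin b |: [set k | (k \notin C) && (src k \in K)].
  rewrite !in_setU !inE pC ?orbF; last by rewrite defp2 mem_cat mem_head orbT.
  by apply: contraNneq bpre => <-; rewrite mem_cat gq orbT.
apply: connect_trans w1' (connect_trans (connect1 (avoid_edge gb)) _).
apply: connect_trans (through _ _ _ bp tgtK gh) _.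
case/or3P: hpos => [/eqP-> //|hp1'|hr]; first by rewrite hp1' in hp1.
case/splitPr: hr defp bpost {defp2} => r1 r2 defp bpost.
move: (wk); rewrite {1}defp -cat_cons.
have -> : p1 ++ (a :: q) ++ b :: r1 ++ h :: r2
    = (p1 ++ a :: q ++ b :: r1) ++ h :: r2 by rewrite -!catA /= -!catA.
rewrite walk_cat_cons => /andP[_ w2].
have hp : h \in p by rewrite defp !(mem_cat, in_cons) eqxx !orbT.
have hF : h \notin b |: [set k | (k \notin C) && (src k \in K)].
  by rewrite !in_setU !inE hC orbF.
apply: connect_trans (connect1 (avoid_edge hF)) (seg b _ _ _ w2 _ _).
  by move=> k kr; rewrite defp !(mem_cat, in_cons) kr !orbT.
by apply: contra bpost => br; rewrite mem_cat in_cons br !orbT.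
Qed.

(** * Existence of peripheral cycles *)

Lemma peripheral_avoiding e f : f != e ->
  exists C, [/\ peripheral C, e \in C & f \notin C].
Proof.
move=> fe.
have [C0 [dC0 eC0 C0f]] : exists C,
    [/\ dicycle C, e \in C & [disjoint C & [set f]]].
  apply: connect_dicycle; last by rewrite in_set1 eq_sym.
  apply: (iffLR (strongly_connected_del _)).
  by apply: hconn; rewrite cards1.
have fC0 : f \notin C0 by apply: contraTN (set11 f) => /(disjointFr C0f) ->.
(* Induction on the number of vertices that the component of the tail of [f] misses. *)
have [n] := ubnP (#|vertex H| - #|component C0 (src f)|).
elim: n C0 dC0 eC0 fC0 {C0f} => // n IHn C dC eC fC lt_n.
case: (pickP [pred y | y \notin component C (src f)]) => [y /= yK|full].
  have [C' [dC' eC' fC' lt]] := enlarge_component dC eC fC yK.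
  apply: IHn dC' eC' fC' _; apply: leq_trans _ (ltnSE lt_n).
  by rewrite ltn_sub2l // (leq_trans lt) ?max_card.
exists C; split=> //; split=> //; apply/strongly_connected_del => x y.
have reach z : connect (avoid C) (src f) z.
  by have := full z; rewrite /= inE => /negbFE.
by apply: connect_trans (reach y); rewrite avoid_dicycle_sym.
Qed.

End Walks.

Theorem theorem7 (H : digraph) (hconn : strongly_edge_connected 2 H)
    (heul : eulerian H) (e : edge H) :
  exists C1 C2 : {set edge H},
    [/\ C1 <> C2, peripheral C1, peripheral C2, e \in C1 & e \in C2].
Proof.
(* This cycle only serves to provide an edge [f0] other than [e]. *)
have [C0 [dC0 eC0 _]] : exists C,
    [/\ dicycle C, e \in C & [disjoint C & set0]].
  apply: connect_dicycle; last by rewrite inE.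
  by apply: (iffLR (strongly_connected_del _)); apply: hconn; rewrite cards0.
have [f0 _ f0e] := dicycle_other_edge dC0 eC0.
have [C1 [perC1 eC1 _]] := peripheral_avoiding heul hconn f0e.
have [f fC1 fe] := dicycle_other_edge perC1.1 eC1.
have [C2 [perC2 eC2 fC2]] := peripheral_avoiding heul hconn fe.
by exists C1, C2; split=> // C12; rewrite -C12 fC1 in fC2.
Qed.
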